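(* Let $\alpha \in \mathbb{Z}[n_1,n_2,n_3,n_4,k]$ satisfy $\alpha(m\boldsymbol{n}, mk) = m^2\alpha(\boldsymbol{n},k)$ (identically) and $\alpha(\boldsymbol{0},k) = k^2$, where $\boldsymbol{n}=(n_1,n_2,n_3,n_4)$. For $\boldsymbol{n}\in\mathbb{Z}_{\ge0}^4$ define \[ A_q^{(\alpha)}(\boldsymbol{n}) = \sum_{k\in\mathbb{Z}} q^{\alpha(\boldsymbol{n},k)}\binom{n_1}{k}_q\binom{n_3}{k}_q\binom{n_1+n_2-k}{n_1}_q\binom{n_3+n_4-k}{n_3}_q . \] Then for every positive integer $m$ and every $\boldsymbol{n}\in\mathbb{Z}_{\ge0}^4$, \[ A_q^{(\alpha)}(m\boldsymbol{n}) \equiv A^{(\alpha)}_{q^{m^2}}(\boldsymbol{n}) - \frac{m^2-1}{12}(q^m-1)^2 R(\boldsymbol{n}) \pmod{\Phi_m(q)^3}, \] where $A^{(\alpha)}_{q^{m^2}}(\boldsymbol{n})$ is $A^{(\alpha)}_q(\boldsymbol{n})$ with $q$ replaced by $q^{m^2}$, and \[ R(\boldsymbol{n}) = \frac{n_1n_2+n_3n_4}{2} A_1^{(\alpha)}(\boldsymbol{n}), \] with $A_1^{(\alpha)}(\boldsymbol{n}) = \sum_{k}\binom{n_1}{k}\binom{n_3}{k}\binom{n_1+n_2-k}{n_1}\binom{n_3+n_4-k}{n_3}$ the value at $q=1$.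
   Context: $[n]_q = 1+q+\cdots+q^{n-1}$, $[n]_q! = [n]_q\cdots[1]_q$, and $\binom{n}{k}_q = \frac{[n]_q!}{[k]_q![n-k]_q!}$ for $0\le k\le n$, with $\binom{n}{k}_q=0$ if $k<0$ or $k>n$ (so the sum over $k$ is finite). $\Phi_m(q)$ is the $m$th cyclotomic polynomial. A congruence $f\equiv g \pmod{\varphi(q)}$ means $f-g = h\varphi$ for some $h\in\mathbb{Q}[q^{\pm1}]$. *)

(* Defs.v *)
(* MathComp, with mpoly from the multinomials library. *)
From HB Require Import structures.
From mathcomp Require Import all_boot all_order all_algebra all_field.
From mathcomp Require Import mpoly.

Set Implicit Arguments.
Unset Strict Implicit.
Unset Printing Implicit Defensive.

Import Order.TTheory GRing.Theory Num.Theory.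
Local Open Scope ring_scope.

(* The q-analogues take q in an arbitrary field, so that replacing q by a
   power of q, or by 1 in characteristic 0, is a mere change of argument.
   [qbinom] is the intended quantity as long as the q-factorials involved do
   not vanish at q: q is an indeterminate, a positive power of one, or 1 in
   characteristic 0. *)
Section QAnalogues.
Variables (F : fieldType) (q : F).

Definition qint (n : nat) : F := \sum_(0 <= i < n) q ^+ i.

Definition qfact (n : nat) : F := \prod_(1 <= i < n.+1) qint i.

Definition qbinom (n k : int) : F :=
  if (0 <= k) && (k <= n)
  then qfact `|n|%N / (qfact `|k|%N * qfact `|n - k|%N)
  else 0.

Variables (alpha : {mpoly int[5]}) (n1 n2 n3 n4 : nat).

(* The variables of [alpha] are n1, n2, n3, n4, k, in this order. *)
Definition alpha_at (k : int) : int :=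
  alpha.@[tnth [tuple n1%:Z; n2%:Z; n3%:Z; n4%:Z; k]].

Definition Aq_term (k : int) : F :=
  q ^ alpha_at k * qbinom n1 k * qbinom n3 k
    * qbinom (n1%:Z + n2%:Z - k) n1 * qbinom (n3%:Z + n4%:Z - k) n3.

(* The sum over all integers k: see [Aq_term_out]. *)
Definition Aq : F := \sum_(0 <= k < n1.+1) Aq_term k%:Z.

Lemma Aq_term_out (k : int) : ~~ (0 <= k <= n1%:Z) -> Aq_term k = 0.
Proof. by move=> /negPf kP; rewrite /Aq_term {1}/qbinom kP mulr0 !mul0r. Qed.

End QAnalogues.

(* Truncated subtraction is harmless: for k > n1 or k > n3 the summand is 0. *)
Definition A1 (n1 n2 n3 n4 : nat) : nat :=
  (\sum_(0 <= k < n1.+1)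
     'C(n1, k) * 'C(n3, k) * 'C(n1 + n2 - k, n1) * 'C(n3 + n4 - k, n3))%N.

Lemma qint1 n : qint (1 : rat) n = n%:R.
Proof.
rewrite /qint (eq_bigr (fun=> 1)) => [|i _]; last by rewrite expr1n.
by rewrite big_const_nat subn0 iter_addr_0.
Qed.

Lemma qfact1 n : qfact (1 : rat) n = n`!%:R.
Proof.
rewrite fact_prod natr_prod; apply: eq_bigr => i _; exact: qint1.
Qed.

Lemma qbinom1 (n k : nat) : qbinom (1 : rat) n k = 'C(n, k)%:R.
Proof.
rewrite /qbinom !lez_nat leq0n /=; case: leqP => [le_kn | lt_nk]; last first.
  by rewrite bin_small.
rewrite subzn //= !qfact1 -natrM -(bin_fact le_kn) natrM.
by rewrite mulfK // pnatr_eq0 -lt0n muln_gt0 !fact_gt0.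
Qed.

Lemma Aq1 alpha n1 n2 n3 n4 :
  Aq (1 : rat) alpha n1 n2 n3 n4 = (A1 n1 n2 n3 n4)%:R.
Proof.
rewrite /Aq /A1 natr_sum !big_mkord; apply: eq_bigr => -[k /=].
rewrite ltnS => le_kn1 _.
rewrite /Aq_term exp1rz mul1r !qbinom1 -!natrM.
case: (leqP k n3) => [le_kn3 | lt_n3k]; last first.
  by rewrite (bin_small lt_n3k) muln0 !mul0n !mul0r.
have le1 : (k <= n1 + n2)%N by rewrite (leq_trans le_kn1) ?leq_addr.
have le3 : (k <= n3 + n4)%N by rewrite (leq_trans le_kn3) ?leq_addr.
by rewrite -!PoszD (subzn le1) (subzn le3) !qbinom1 -!natrM.
Qed.

Definition Rn (n1 n2 n3 n4 : nat) : rat :=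
  (n1 * n2 + n3 * n4)%:R / 2 * (A1 n1 n2 n3 n4)%:R.

(* Q[q, q^-1] is handled as a subring of the field Q(q). *)
Definition Qq := {fraction {poly rat}}.

Definition q_ : Qq := tofrac 'X.

Definition cst (c : rat) : Qq := tofrac c%:P.

Definition laurent (f : Qq) : Prop :=
  exists (p : {poly rat}) (N : nat), f = tofrac p / q_ ^+ N.

Definition PhiQ (m : nat) : Qq := tofrac (map_poly (intr : int -> rat) 'Phi_m).

Definition laurent_eqmod (f g phi : Qq) : Prop :=
  exists2 h : Qq, laurent h & f - g = h * phi.

(* alpha (m n, m k) = m^2 alpha (n, k), as polynomials in n and k. *)
Definition quadratic_scaling (alpha : {mpoly int[5]}) : Prop :=
  forall m : int,
    alpha \mPo [tuple m *: 'X_i | i < 5] = (m ^+ 2) *: alpha.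

(* alpha (0, k) = k^2, as polynomials; k is the variable of index 4. *)
Definition square_at_zero (alpha : {mpoly int[5]}) : Prop :=
  let k : {mpoly int[5]} := 'X_ord_max in
  alpha \mPo [tuple 0; 0; 0; 0; k] = k ^+ 2.

(* Main.v *)
(* The terms of A_q(m n) with m | k and with m not dividing k are treated apart.
   Let S be the sum of q^(c^2) binom(m,c)_q^2 over 0 < c < m.  By induction on n
   with the q-Vandermonde identity, whose terms with m not dividing the index
   are divisible by Phi_m or its square, one gets, with C = binomials at q = 1:
     binom(m n, m j + r)_q = n C(n-1, j) binom(m, r)_q   mod Phi_m^2 (0 < r < m),
     binom(m n, m j)_q = binom(n, j)_{q^(m^2)} + j (n-j) C(n, j) S / 2
                                                         mod Phi_m^3.
   As alpha(m n, k) = k^2 mod m, the terms k = m j + r, 0 < r < m, then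
   contribute S times the sum of j^2 times the j-th term of A_1(n), which turns
   the correction of the terms k = m j into (n1 n2 + n3 n4) A_1(n) S / 2.
   Finally S = - (m^2 - 1) / 12 (q^m - 1)^2 mod Phi_m^3: dividing by Phi_m^2 and
   evaluating at a primitive m-th root of unity z, this reads
     sum_{0 < c < m} z^c / (1 - z^c)^2 = - (m^2 - 1) / 12. *)
Require Import Defs.
From mathcomp Require Import all_boot all_order all_algebra all_field.
From mathcomp Require Import mpoly.
From mathcomp Require Import zify ring.

Set Implicit Arguments.
Unset Strict Implicit.
Unset Printing Implicit Defensive.

Import Order.TTheory GRing.Theory Num.Theory.
Local Open Scope ring_scope.

(** * Gaussian binomials *)

Section GaussianBinomial.
Variables (R : comNzRingType) (q : R).

(** The q-Pascal recursion needs no division, so it makes sense in any commutative ring, and at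
    roots of unity where q-factorials vanish. *)
Fixpoint gbinom (n k : nat) : R :=
  match n, k with
  | _, 0 => 1
  | 0, _.+1 => 0
  | n'.+1, k'.+1 => gbinom n' k' + q ^+ k * gbinom n' k
  end.

Lemma gbinom0 n : gbinom n 0 = 1. Proof. by case: n. Qed.

Lemma gbinomS n k :
  gbinom n.+1 k.+1 = gbinom n k + q ^+ k.+1 * gbinom n k.+1.
Proof. by []. Qed.

Lemma gbinom_small n k : (n < k)%N -> gbinom n k = 0.
Proof.
elim: n k => [|n IHn] [|k] //= nk.
by rewrite !IHn ?mulr0 ?addr0 // ltnW.
Qed.

Lemma gbinomnn n : gbinom n n = 1.
Proof. by elim: n => //= n ->; rewrite gbinom_small // mulr0 addr0. Qed.

Lemma gbinom_step n k : (k <= n)%N ->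
  gbinom n k.+1 * (1 - q ^+ k.+1) = gbinom n k * (1 - q ^+ (n - k)).
Proof.
elim: n k => [|n IHn] k; first by case: k => //= _; rewrite subrr !mulr0 mul0r.
rewrite leq_eqVlt => /predU1P[->|].
  by rewrite gbinom_small // subnn subrr mulr0 mul0r.
rewrite ltnS => le_kn; case: k le_kn => [_|k lt_kn].
  have E := IHn 0%N isT; rewrite gbinom0 subn0 expr1 in E.
  rewrite gbinomS !gbinom0 expr1 subn0 mulrDl -mulrA E exprS; ring.
have le_kn := ltnW lt_kn.
have Eq : q ^+ n.+1 = q ^+ k.+1 * q ^+ (n - k) by rewrite -exprD; congr (_ ^+ _); lia.
have Ek : q ^+ (n - k) = q * q ^+ (n - k.+1) by rewrite -exprS; congr (_ ^+ _); lia.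
have IH1 := IHn _ le_kn; have IH2 := IHn _ lt_kn.
rewrite subSS.
transitivity (gbinom n k.+1 * (1 - q ^+ n.+1)).
  rewrite gbinomS mulrDl -mulrA IH2 Eq Ek (exprS q k.+1); ring.
rewrite gbinomS mulrDl -IH1 Eq; ring.
Qed.

Lemma gbinom_absorb n k :
  gbinom n.+1 k.+1 * (1 - q ^+ k.+1) = (1 - q ^+ n.+1) * gbinom n k.
Proof.
have [le_kn|lt_nk] := leqP k n; last by rewrite !gbinom_small // mul0r mulr0.
have Eq : q ^+ n.+1 = q ^+ k.+1 * q ^+ (n - k) by rewrite -exprD; congr (_ ^+ _); lia.
rewrite gbinomS mulrDl -mulrA gbinom_step // Eq; ring.
Qed.

(** The two q-Pascal rules differ exactly by [gbinom_step]. *)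
Lemma gbinomS' n k : (k <= n)%N ->
  gbinom n.+1 k.+1 = q ^+ (n - k) * gbinom n k + gbinom n k.+1.
Proof.
move=> /gbinom_step E; rewrite gbinomS.
apply/eqP; rewrite -subr_eq0; apply/eqP.
transitivity (gbinom n k * (1 - q ^+ (n - k))
              - gbinom n k.+1 * (1 - q ^+ k.+1)); first by ring.
by rewrite E subrr.
Qed.

Lemma gbinom_sub n k : (k <= n)%N -> gbinom n (n - k) = gbinom n k.
Proof.
elim: n k => [|n IHn] [|k] // le_kn; first by rewrite subn0 gbinomnn gbinom0.
rewrite subSS; move: le_kn; rewrite ltnS leq_eqVlt => /predU1P[->|lt_kn].
  by rewrite subnn gbinomnn gbinom0.
have le_kn := ltnW lt_kn.
rewrite -[in LHS](subnSK lt_kn) gbinomS IHn // (subnSK lt_kn) IHn //.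
by rewrite gbinomS' // addrC.
Qed.

Lemma gbinom_Vandermonde a b k :
  gbinom (a + b) k =
  \sum_(0 <= c < a.+1 | (c <= k)%N)
     gbinom a c * gbinom b (k - c) * q ^+ ((a - c) * (k - c)).
Proof.
elim: a k => [|a IHa] k.
  by rewrite big_mkcond big_nat1 /= subn0 mul0n !mul1r mulr1.
case: k => [|k].
  rewrite big_mkcond big_nat_recl //= big1 ?addr0 //.
  by rewrite gbinom0 muln0 !mulr1.
rewrite addSn gbinomS !IHa.
rewrite [in RHS]big_mkcond big_nat_recl //=.
(* [t1] and [t2] are the terms of the two sums given by the induction hypothesis; q-Pascal splits
   the term of index c + 1 into [t1 c + t2 c.+1]. *)
pose t1 c := gbinom a c * gbinom b (k - c) * q ^+ ((a - c) * (k - c)).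
pose t2 c := q ^+ k.+1 * (gbinom a c * gbinom b (k.+1 - c) * q ^+ ((a - c) * (k.+1 - c))).
rewrite [X in _ = _ + X](eq_bigr (fun c => (if (c <= k)%N then t1 c else 0)
  + (if (c.+1 <= k.+1)%N then t2 c.+1 else 0))); last first.
  move=> c _; rewrite !ltnS; case: leqP => le_ck; last by rewrite addr0.
  rewrite /t1 /t2 !subSS 2!mulrDl; congr (_ + _).
  (* For c >= a truncated subtraction spoils the exponents, but the binomial they multiply is 0. *)
  have [lt_ca|le_ac] := ltnP c a; last by rewrite gbinom_small // !(mulr0, mul0r).
  have E : q ^+ c.+1 * q ^+ ((a - c) * (k - c))
         = q ^+ k.+1 * q ^+ ((a - c.+1) * (k - c)).
    by rewrite -!exprD; congr (_ ^+ _); nia.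
  rewrite mulrAC [X in X * _ = _]mulrAC E; ring.
rewrite big_split /= -(big_mkcond (fun c => c <= k)%N) /= addrCA; congr (_ + _).
transitivity (\sum_(0 <= c < a.+2) (if (c <= k.+1)%N then t2 c else 0)); last first.
  rewrite [LHS]big_nat_recl //=; congr (_ + _).
  rewrite /t2 !gbinom0 !subn0 !mul1r mulrCA; congr (_ * _).
  by rewrite -exprD mulSn.
rewrite big_nat_recr //= -big_mkcond mulr_sumr.
by rewrite {2}/t2 gbinom_small ?mul0r ?mulr0 ?if_same ?addr0.
Qed.

End GaussianBinomial.

Lemma rmorph_gbinom (R S : comNzRingType) (f : {rmorphism R -> S}) (q : R) n k :
  f (gbinom q n k) = gbinom (f q) n k.
Proof.
elim: n k => [|n IHn] [|k] /=; rewrite ?rmorph0 ?rmorph1 //.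
by rewrite rmorphD rmorphM !rmorphXn !IHn.
Qed.

Section QBinomial.
Variables (F : fieldType) (q : F).
Hypothesis q_free : forall i, (0 < i)%N -> q ^+ i != 1.

Let subq_neq0 i : (0 < i)%N -> 1 - q ^+ i != 0.
Proof. by move=> i_gt0; rewrite subr_eq0 eq_sym q_free. Qed.

Lemma qint_geom n : qint q n = (1 - q ^+ n) / (1 - q).
Proof.
have q1 : 1 - q != 0 by rewrite -[q]expr1 subq_neq0.
apply: (canRL (mulfK q1)); rewrite mulrC /qint big_mkord -{2}(expr1n F n).
by rewrite subrXX; congr (_ * _); apply: eq_bigr => i _; rewrite expr1n mul1r.
Qed.

Lemma qint_neq0 n : (0 < n)%N -> qint q n != 0.
Proof.
move=> n_gt0; rewrite qint_geom mulf_neq0 ?invr_eq0 ?subq_neq0 //.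
by rewrite -[q]expr1 subq_neq0.
Qed.

Lemma qfact_neq0 n : qfact q n != 0.
Proof.
rewrite /qfact big_nat; apply: (big_ind (fun x => x != 0)) => //.
- exact: oner_neq0.
- exact: mulf_neq0.
- by move=> i /andP[i_gt0 _]; apply: qint_neq0.
Qed.

Lemma qfactS n : qfact q n.+1 = qint q n.+1 * qfact q n.
Proof. by rewrite /qfact big_nat_recr //= mulrC. Qed.

Lemma gbinom_fact n k : (k <= n)%N ->
  gbinom q n k * (qfact q k * qfact q (n - k)) = qfact q n.
Proof.
elim: n k => [|n IHn] [|k] // le_kn.
- by rewrite /qfact !big_geq //= !mulr1.
- by rewrite gbinom0 mul1r subn0 {1}/qfact big_geq // mul1r.
rewrite subSS !qfactS !qint_geom -(IHn k) //.
have := gbinom_absorb q n k => E.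
rewrite -[_ / _ * qfact q k]mulrA -mulrA !mulrA E; ring.
Qed.

Lemma qbinom_nat (n k : nat) : qbinom q n k = gbinom q n k.
Proof.
rewrite /qbinom !lez_nat leq0n /=; case: leqP => [le_kn|lt_nk]; last first.
  by rewrite gbinom_small.
rewrite subzn //= -(gbinom_fact le_kn) mulfK //.
by rewrite mulf_neq0 ?qfact_neq0.
Qed.

End QBinomial.

(** * Congruences *)

Section Congruence.
Variable R : comNzRingType.
Implicit Types d e x y z : R.

(** Congruence in any commutative ring, used for polynomials and for integer exponents; the oriented
    equation lets x be substituted. *)
Definition eqm d x y := exists h, x = y + h * d.

Lemma eqmxx d x : eqm d x x.
Proof. by exists 0; rewrite mul0r addr0. Qed.

Lemma eqm_sym d x y : eqm d x y -> eqm d y x.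
Proof. by case=> h ->; exists (- h); ring. Qed.

Lemma eqm_trans y d x z : eqm d x y -> eqm d y z -> eqm d x z.
Proof. by case=> h -> [g ->]; exists (h + g); ring. Qed.

Lemma eqmD d x y x' y' : eqm d x y -> eqm d x' y' -> eqm d (x + x') (y + y').
Proof. by case=> h -> [g ->]; exists (h + g); ring. Qed.

Lemma eqmM d x y x' y' : eqm d x y -> eqm d x' y' -> eqm d (x * x') (y * y').
Proof. by case=> h -> [g ->]; exists (h * y' + y * g + h * g * d); ring. Qed.

Lemma eqmMl d z x y : eqm d x y -> eqm d (z * x) (z * y).
Proof. exact: eqmM (eqmxx _ _). Qed.

Lemma eqmMr d z x y : eqm d x y -> eqm d (x * z) (y * z).
Proof. by move/eqmM; apply; apply: eqmxx. Qed.

Lemma eqmD0 d x y : eqm d x 0 -> eqm d y 0 -> eqm d (x + y) 0.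
Proof. by move=> x0 /(eqmD x0); rewrite addr0. Qed.

Lemma eqmMl0 d z x : eqm d x 0 -> eqm d (z * x) 0.
Proof. by move/(eqmMl z); rewrite mulr0. Qed.

Lemma eqmMr0 d z x : eqm d x 0 -> eqm d (x * z) 0.
Proof. by rewrite mulrC; apply: eqmMl0. Qed.

Lemma eqmMn d n x y : eqm d x y -> eqm d (x *+ n) (y *+ n).
Proof. by rewrite -(mulr_natl x) -(mulr_natl y); apply: eqmMl. Qed.

Lemma eqmX d n x y : eqm d x y -> eqm d (x ^+ n) (y ^+ n).
Proof.
by move=> xy; elim: n => [|n IHn]; rewrite ?exprS; [apply: eqmxx | apply: eqmM].
Qed.

Lemma eqm_sum d a b (C : pred nat) (F G : nat -> R) :
    (forall i, (a <= i < b)%N -> C i -> eqm d (F i) (G i)) ->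
  eqm d (\sum_(a <= i < b | C i) F i) (\sum_(a <= i < b | C i) G i).
Proof.
move=> FG; rewrite big_nat_cond [X in eqm _ _ X]big_nat_cond.
apply: (big_ind2 (eqm d)); first exact: eqmxx.
  by move=> *; apply: eqmD.
by move=> i /andP[iab Ci]; apply: FG.
Qed.

Lemma eqm_sum0 d a b (C : pred nat) (F : nat -> R) :
    (forall i, (a <= i < b)%N -> C i -> eqm d (F i) 0) ->
  eqm d (\sum_(a <= i < b | C i) F i) 0.
Proof.
by move=> F0; rewrite -[X in eqm _ _ X](@big1_eq _ 0 +%R _ (index_iota a b) C); apply: eqm_sum.
Qed.

Lemma eqm_leq d a b x y : (a <= b)%N -> eqm (d ^+ b) x y -> eqm (d ^+ a) x y.
Proof.
by move=> le_ab [h ->]; exists (h * d ^+ (b - a)); rewrite -mulrA -exprD subnK.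
Qed.

(** A factor divisible by d^a raises the precision: the other factor is needed only modulo d^b. *)
Lemma eqm_lift d a b z x y : eqm (d ^+ a) z 0 -> eqm (d ^+ b) x y ->
  eqm (d ^+ (a + b)) (z * x) (z * y).
Proof. by case=> h -> [g ->]; exists (h * g); rewrite exprD; ring. Qed.

Lemma eqm_lift0 d a b z x : eqm (d ^+ a) z 0 -> eqm (d ^+ b) x 0 ->
  eqm (d ^+ (a + b)) (z * x) 0.
Proof. by move=> z0 /(eqm_lift z0); rewrite mulr0. Qed.

End Congruence.

(** * Gaussian binomials at multiples of m, modulo P and P^2; P stands for Phi_m *)

Section Blocks.
Variables (R : comNzRingType) (q P : R) (m : nat).
Hypotheses (m_gt0 : (0 < m)%N) (qm1 : eqm P (q ^+ m) 1).
Hypothesis gbinom_m : forall c, (0 < c < m)%N -> eqm P (gbinom q m c) 0.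
Local Notation gb := (gbinom q).

Lemma eqm_expq a b : a = b %[mod m] -> eqm P (q ^+ a) (q ^+ b).
Proof.
have red c : eqm P (q ^+ c) (q ^+ (c %% m)).
  rewrite {1}(divn_eq c m) exprD mulnC exprM -[X in eqm _ _ X]mul1r.
  by apply: eqmMr; rewrite -(expr1n _ (c %/ m)); apply: eqmX.
by move=> ab; apply: eqm_trans (red a) _; rewrite ab; apply/eqm_sym/red.
Qed.

Lemma eqm_expqm a : eqm P (q ^+ (m * a)) 1.
Proof. by rewrite -(expr0 q); apply: eqm_expq; rewrite modnMr mod0n. Qed.

(** q-Vandermonde for m + m n, with c = 0 and c = m set apart: every other term has the factor
    [gb m c], divisible by P. *)
Lemma gbinom_block n k : gb (m * n.+1) k =
  q ^+ (m * k) * gb (m * n) k + (if (m <= k)%N then gb (m * n) (k - m) else 0)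
  + \sum_(1 <= c < m | (c <= k)%N)
      gb m c * gb (m * n) (k - c) * q ^+ ((m - c) * (k - c)).
Proof.
rewrite mulnS gbinom_Vandermonde.
rewrite big_mkcond big_nat_recr //= subnn mul0n mulr1 gbinomnn mul1r.
rewrite big_ltn //= gbinom0 !subn0 mul1r -big_mkcond /= -!addrA.
by rewrite [_ * gb _ _]mulrC; congr (_ + _); rewrite addrC.
Qed.

Lemma gbinom_ndvd n k : ~~ (m %| k)%N -> eqm P (gb (m * n) k) 0.
Proof.
elim: n k => [|n IHn] k mk.
  by rewrite muln0 gbinom_small; [apply: eqmxx | case: k mk; rewrite ?dvdn0].
rewrite gbinom_block; apply: eqmD0; first apply: eqmD0.
- exact/eqmMl0/IHn.
- case: leqP => [le_mk|_]; last exact: eqmxx.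
  by apply: IHn; rewrite dvdn_subl.
- by apply: eqm_sum0 => c cm _; apply/eqmMr0/eqmMr0/gbinom_m.
Qed.

(** Modulo P the block recursion reduces to Pascal's rule. *)
Lemma gbinom_dvd n k : eqm P (gb (m * n) (m * k)) 'C(n, k)%:R.
Proof.
elim: n k => [|n IHn] [|k]; rewrite ?muln0 ?gbinom0 ?bin0; try exact: eqmxx.
  by rewrite gbinom_small ?muln_gt0 ?m_gt0 //; apply: eqmxx.
rewrite gbinom_block binS natrD -[X in eqm _ _ X]addr0.
rewrite mulnS leq_addr addKn.
apply: eqmD; first apply: eqmD => //.
  rewrite -mulnS -[X in eqm _ _ X]mul1r; apply: eqmM (IHn _).
  exact: eqm_expqm.
by apply: eqm_sum0 => c cm _; apply/eqmMr0/eqmMr0/gbinom_m.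
Qed.

(** Of the middle terms only c = k mod m survives modulo P^2: otherwise m does not divide k - c, and
    [gb (m * n) (k - c)] supplies a second factor P. *)
Lemma gbinom_ndvd2 n k : ~~ (m %| k)%N ->
  eqm (P ^+ 2) (gb (m * n) k) (gb m (k %% m) *+ (n * 'C(n.-1, k %/ m))).
Proof.
elim: n k => [|n IHn] k mk.
  by rewrite muln0 gbinom_small; [apply: eqmxx | case: k mk; rewrite ?dvdn0].
have k_mod : (0 < k %% m < m)%N by rewrite lt0n -/(dvdn m k) mk ltn_mod.
rewrite gbinom_block /=.
(* The coefficients obey the same recursion, by Pascal's rule. *)
have -> : (n.+1 * 'C(n, k %/ m) = n * 'C(n.-1, k %/ m)
    + (if (m <= k)%N then n * 'C(n.-1, (k - m) %/ m) else 0) + 'C(n, k %/ m))%N.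
  case: leqP => [le_mk|lt_km]; last first.
    by rewrite divn_small // !bin0 mulSn addn0 addnC.
  have -> : (k %/ m = ((k - m) %/ m).+1)%N.
    by rewrite -{1}(subnK le_mk) divnDr // divnn m_gt0 addn1.
  by case: n {IHn} => [|n] //=; rewrite binS; nia.
rewrite !mulrnDr; apply: eqmD; first apply: eqmD.
- apply: eqm_trans (IHn _ mk); rewrite mulrC -[X in eqm _ _ X]mulr1.
  exact: (@eqm_lift _ P 1 1 _ _ _ (gbinom_ndvd n mk) (eqm_expqm k)).
- case: leqP => [le_mk|_]; last exact: eqmxx.
  have := IHn (k - m)%N; rewrite dvdn_subl // => /(_ mk).
  by rewrite -[in X in _ -> X](subnK le_mk) modnDr subnK.
apply: (@eqm_trans _ (\sum_(1 <= c < m | c == k %% m) gb m c *+ 'C(n, k %/ m)))%N; last first.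
  by rewrite big_nat1_eq k_mod; apply: eqmxx.
rewrite big_mkcond [X in eqm _ _ X]big_mkcond /=; apply: eqm_sum => c cm _.
case: eqP => [ck|/eqP ck].
  rewrite ck leq_mod -ck -mulrA -mulr_natr.
  apply: (@eqm_lift _ P 1 1); first exact: gbinom_m.
  have -> : (k - c = m * (k %/ m))%N by rewrite ck {1}(divn_eq k m) addnK mulnC.
  rewrite -[X in eqm _ _ X]mulr1; apply: eqmM; first exact: gbinom_dvd.
  by rewrite mulnCA; apply: eqm_expqm.
case: leqP => [le_ck|_]; last exact: eqmxx.
rewrite -mulrA; apply: (@eqm_lift0 _ P 1 1); first exact: gbinom_m.
apply/eqmMr0/gbinom_ndvd; apply: contra ck => /eqnP; rewrite -/(modn _ _) => mkc.
case/andP: cm => c_gt0 c_lt.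
by rewrite -(subnK le_ck) -modnDml mkc add0n modn_small.
Qed.

(** q-Vandermonde for s + m n: the terms with 0 < c <= s vanish modulo P, since m does not divide m
    k - c. *)
Lemma gbinom_Lucas n s k : (s < m)%N ->
  eqm P (gb (m * n + s) (m * k)) 'C(n, k)%:R.
Proof.
move=> s_lt; rewrite addnC gbinom_Vandermonde big_mkcond big_ltn //= -[X in eqm _ _ X]addr0.
apply: eqmD.
  rewrite gbinom0 mul1r !subn0 -[X in eqm _ _ X]mulr1; apply: eqmM; first exact: gbinom_dvd.
  by rewrite mulnCA; apply: eqm_expqm.
apply: eqm_sum0 => c /andP[c_gt0 c_le] _; case: leqP => [le_ck|_]; last exact: eqmxx.
apply/eqmMr0/eqmMl0/gbinom_ndvd.
by rewrite dvdn_subr ?dvdn_mulr // gtnNdvd // (leq_trans c_le).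
Qed.

End Blocks.

Lemma eqm_gbinom (R : comNzRingType) (d x y : R) n k :
  eqm d x y -> eqm d (gbinom x n k) (gbinom y n k).
Proof.
move=> xy; elim: n k => [|n IHn] [|k] /=; try exact: eqmxx.
exact: (eqmD (IHn _) (eqmM (eqmX _ xy) (IHn _))).
Qed.

Lemma gbinom1 (R : comNzRingType) n k : gbinom (1 : R) n k = 'C(n, k)%:R.
Proof.
elim: n k => [|n IHn] [|k]; rewrite ?gbinom0 ?bin0 ?bin0n //.
by rewrite gbinomS !IHn expr1n mul1r -natrD addnC.
Qed.

Lemma sum_blocks (R : nmodType) (F : nat -> R) m b :
  \sum_(0 <= k < m * b) F k = \sum_(0 <= j < b) \sum_(0 <= r < m) F (m * j + r)%N.
Proof.
elim: b => [|b IHb]; first by rewrite muln0 !big_geq.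
rewrite big_nat_recr //= -IHb mulnS addnC (@big_cat_nat _ _ _ (m * b)) ?leq_addr //=.
rewrite -{2}[(m * b)%N]add0n big_addn addKn; congr (_ + _).
by apply: eq_bigr => r _; rewrite addnC.
Qed.

(** * Integer identities for the terms of A_1 *)

Section AperyNumber.
Variables n1 n2 n3 n4 : nat.

Definition A1_term j :=
  ('C(n1, j) * 'C(n3, j) * 'C(n1 + n2 - j, n1) * 'C(n3 + n4 - j, n3))%N.

(* T A1_diag j A1_term j, with 2 T = gbinom_defect q m, is the correction coming
   from k = m j, and 2 T A1_off j the sum over m j < k < m (j + 1). *)
Definition A1_diag j := (j * (n1 - j) + j * (n3 - j)
  + n1 * (n1 + n2 - j - n1) + n3 * (n3 + n4 - j - n3))%N.

Definition A1_off j := (n1 * 'C(n1.-1, j) * (n3 * 'C(n3.-1, j))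
  * 'C(n1 + n2 - j.+1, n1) * 'C(n3 + n4 - j.+1, n3))%N.

(** By n C(n-1, j) = (j+1) C(n, j+1), the indices strictly between m j and m (j+1) are charged to
    the term j + 1. *)
Lemma A1_offE j : A1_off j = (j.+1 ^ 2 * A1_term j.+1)%N.
Proof. by rewrite /A1_off /A1_term !mul_bin_diag; ring. Qed.

(** If the term is nonzero, all truncated subtractions are exact and [A1_diag j] is n1 n2 + n3 n4 -
    2 j^2. *)
Lemma A1_diagE j :
  (A1_diag j * A1_term j + 2 * (j ^ 2 * A1_term j) = (n1 * n2 + n3 * n4) * A1_term j)%N.
Proof.
have [A0|A_gt0] := posnP (A1_term j); first by rewrite A0 !muln0.
move: A_gt0; rewrite {1}/A1_term !muln_gt0 !bin_gt0 => /andP[/andP[/andP[j1 j3] j2] j4].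
rewrite mulnA -mulnDl; congr (_ * _)%N; rewrite /A1_diag; nia.
Qed.

Lemma A1_sum : (\sum_(0 <= j < n1.+1) (A1_diag j * A1_term j + 2 * A1_off j)
  = (n1 * n2 + n3 * n4) * A1 n1 n2 n3 n4)%N.
Proof.
rewrite big_split /= -big_distrr /=.
(* The index shift is free: j = 0 has weight 0 and the term of index n1 + 1 vanishes. *)
have -> : (\sum_(0 <= j < n1.+1) A1_off j = \sum_(0 <= j < n1.+1) j ^ 2 * A1_term j)%N.
  under eq_bigr do rewrite A1_offE.
  transitivity (\sum_(0 <= j < n1.+2) j ^ 2 * A1_term j)%N.
    by rewrite [RHS]big_nat_recl.
  by rewrite big_nat_recr //= {2}/A1_term bin_small // !mul0n muln0 addn0.
rewrite big_distrr /= -big_split /= /A1 big_distrr /=.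
by apply: eq_bigr => j _; rewrite A1_diagE.
Qed.

End AperyNumber.

(** * The supercongruence modulo P^3 in an abstract ring *)

Section Supercongruence.
Variables (R : comNzRingType) (q P half : R) (m : nat).
Hypotheses (m_gt0 : (0 < m)%N) (qm1 : eqm P (q ^+ m) 1).
Hypothesis gbinom_m : forall c, (0 < c < m)%N -> eqm P (gbinom q m c) 0.
Hypothesis half2 : half *+ 2 = 1.
Local Notation gb := (gbinom q).
Local Notation gbQ := (gbinom (q ^+ (m ^ 2))).

(** The sum S. Each term has two factors [gb m c], so S and T = S / 2 vanish modulo P^2, and a
    cofactor of T matters only modulo P. *)
Definition gbinom_defect := \sum_(1 <= c < m) q ^+ (c ^ 2) * gb m c ^+ 2.

Let T := half * gbinom_defect.

Let gbinom_m2 c : (0 < c < m)%N -> eqm (P ^+ 2) (gb m c ^+ 2) 0.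
Proof. by move=> /gbinom_m ?; apply: (@eqm_lift0 _ P 1 1). Qed.

Let T2 : T *+ 2 = gbinom_defect.
Proof. by rewrite -mulrnAl half2 mul1r. Qed.

Let T0 : eqm (P ^+ 2) T 0.
Proof. by apply/eqmMl0/eqm_sum0 => c cm _; apply/eqmMl0/gbinom_m2. Qed.

Let TM x y : eqm P x y -> eqm (P ^+ 3) (T * x) (T * y).
Proof. exact: (@eqm_lift _ P 2 1). Qed.

(** A q-analogue of Ljunggren's congruence. The extreme terms of the block recursion form the
    q-Pascal rule in base q^(m^2); the middle ones give a multiple of S. *)
Lemma gbinom_Ljunggren n k : eqm (P ^+ 3) (gb (m * n) (m * k))
  (gbQ n k + T *+ (k * (n - k) * 'C(n, k))).
Proof.
elim: n k => [|n IHn] [|k]; rewrite ?muln0 ?gbinom0 ?mul0n ?mulr0n ?addr0; try exact: eqmxx.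
  rewrite !gbinom_small ?muln_gt0 ?m_gt0 //; apply: eqmxx.
(* Uses n C(n-1, k) = (k+1) C(n, k+1) = (n-k) C(n, k). *)
have -> : (k.+1 * (n.+1 - k.+1) * 'C(n.+1, k.+1)
   = k.+1 * (n - k.+1) * 'C(n, k.+1) + k * (n - k) * 'C(n, k) + 2 * (n * 'C(n.-1, k)))%N.
  rewrite mul_bin_diag binS subSS.
  have [lt_nk|lt_kn|->] := ltngtP n k; last 1 first.
  - by rewrite subnn (bin_small (ltnSn k)) !(muln0, mul0n).
  - by rewrite !bin_small ?muln0 // ltnW.
  have := mul_bin_left n k; rewrite (mulnC (n - k)%N) => E; nia.
have S0 : eqm (P ^+ 3) (q ^+ (m * (m * k.+1)) * gb (m * n) (m * k.+1))
    ((q ^+ (m ^ 2)) ^+ k.+1 * gbQ n k.+1 + T *+ (k.+1 * (n - k.+1) * 'C(n, k.+1))).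
  rewrite -exprM -[(m ^ 2)%N]/(m * m)%N -mulnA.
  apply: eqm_trans (eqmMl _ (IHn _)) _; rewrite mulrDr; apply: eqmD (eqmxx _ _) _.
  rewrite mulrnAr; apply: eqmMn; rewrite mulrC -[X in eqm _ _ X]mulr1.
  by apply: TM; apply: eqm_expqm.
have S2 : eqm (P ^+ 3) (\sum_(1 <= c < m | (c <= m * k.+1)%N)
      gb m c * gb (m * n) (m * k.+1 - c) * q ^+ ((m - c) * (m * k.+1 - c)))
    (T *+ (2 * (n * 'C(n.-1, k)))).
  rewrite mulrnA T2 -sumrMnl big_mkcond; apply: eqm_sum => c cm _.
  have [c_gt0 c_lt] := andP cm.
  have c_le : (c <= m * k.+1)%N by rewrite mulnS ltnW // ltn_addr.
  (* The lower index has residue m - c, and [gb m (m - c) = gb m c] produces the square in S. *)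
  rewrite c_le (_ : m * k.+1 - c = k * m + (m - c))%N; last by rewrite mulnS; nia.
  have lt_mc : (m - c < m)%N by lia.
  have := gbinom_ndvd2 m_gt0 qm1 gbinom_m n (k := k * m + (m - c)).
  rewrite dvdn_addr ?dvdn_mull // gtnNdvd ?subn_gt0 // => /(_ isT).
  rewrite divnMDl // modnMDl modn_small // divn_small // addn0 gbinom_sub ?(ltnW c_lt) // => E.
  apply: (@eqm_trans _ (gb m c ^+ 2 * q ^+ ((m - c) * (k * m + (m - c))) *+ (n * 'C(n.-1, k)))).
    rewrite -mulrnAl; apply: eqmMr; rewrite expr2 -mulrnAr.
    exact: (@eqm_lift _ P 1 2 _ _ _ (gbinom_m cm) E).
  apply: eqmMn; rewrite mulrC [X in eqm _ X _]mulrC [X in eqm _ _ X]mulrC.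
  apply: (@eqm_lift _ P 2 1 _ _ _ (gbinom_m2 cm)); apply: (eqm_expq (m := m)) => //.
  have -> : ((m - c) * (k * m + (m - c)) = (m - c) * k * m + (m - c) * (m - c))%N by ring.
  (* The exponent is c^2 modulo m, as (m-c)^2 + 2 c m = m m + c^2. *)
  rewrite modnMDl -(modnMDl (2 * c) (_ * _)) -[in RHS](modnMDl m).
  by congr (_ %% _)%N; nia.
rewrite (gbinom_block q m_gt0).
have -> : (m <= m * k.+1)%N by rewrite mulnS leq_addr.
have -> : (m * k.+1 - m = m * k)%N by rewrite mulnS addKn.
apply: eqm_trans (eqmD (eqmD S0 (IHn k)) S2) _.
by exists 0; rewrite gbinomS !mulrnDr; ring.
Qed.


(* First-order expansion in T, whose square vanishes mod P^3. *)
Let near x g c a := eqm (P ^+ 3) x (g + T * a) /\ eqm P g c.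

(** The product rule; in the coefficient of T, the main terms g and h may be replaced by their
    residues c and d modulo P. *)
Let nearM x y g h c d a b : near x g c a -> near y h d b ->
  near (x * y) (g * h) (c * d) (c * b + d * a).
Proof.
move=> [xg gc] [yh hd]; split; last exact: eqmM.
apply: eqm_trans (eqmM xg yh) _.
have -> : (g + T * a) * (h + T * b) = g * h + (T * (g * b + h * a) + (T * T) * (a * b)).
  by ring.
apply: eqmD (eqmxx _ _) _; rewrite -[X in eqm _ _ X]addr0; apply: eqmD.
  by apply/TM/eqmD; apply: eqmMr.
apply: eqmMr0; apply: (@eqm_leq _ P 3 4) => //; exact: (@eqm_lift0 _ P 2 2).
Qed.

Let near_gb n k : near (gb (m * n) (m * k)) (gbQ n k) 'C(n, k)%:R
  (k * (n - k) * 'C(n, k))%:R.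
Proof.
split; first by rewrite mulr_natr; apply: gbinom_Ljunggren.
rewrite -(gbinom1 R); apply: eqm_gbinom; rewrite -[(m ^ 2)%N]/(m * m)%N.
exact: eqm_expqm.
Qed.

(** The weight w stands for q^alpha times a power of q that makes the exponents nonnegative; besides
    its values at multiples of m, only its residues modulo P enter. *)
Lemma gbinom_supercongruence (n1 n2 n3 n4 : nat) (w : nat -> R) :
    (forall j r, (r < m)%N -> (m * j + r <= m * n1)%N ->
      eqm P (w (m * j + r)%N) (q ^+ (r ^ 2))) ->
  eqm (P ^+ 3)
    (\sum_(0 <= k < (m * n1).+1) w k * gb (m * n1) k * gb (m * n3) k
       * gb (m * n1 + m * n2 - k) (m * n1) * gb (m * n3 + m * n4 - k) (m * n3))
    (\sum_(0 <= j < n1.+1) w (m * j)%N * gbQ n1 j * gbQ n3 j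
       * gbQ (n1 + n2 - j) n1 * gbQ (n3 + n4 - j) n3
     + half * gbinom_defect *+ ((n1 * n2 + n3 * n4) * A1 n1 n2 n3 n4)).
Proof.
move=> w_mod; rewrite -/T.
pose F k := w k * gb (m * n1) k * gb (m * n3) k
  * gb (m * n1 + m * n2 - k) (m * n1) * gb (m * n3 + m * n4 - k) (m * n3).
pose V j := w (m * j)%N * gbQ n1 j * gbQ n3 j
  * gbQ (n1 + n2 - j) n1 * gbQ (n3 + n4 - j) n3.
suff: eqm (P ^+ 3) (\sum_(0 <= k < (m * n1).+1) F k)
  (\sum_(0 <= j < n1.+1) V j + T *+ ((n1 * n2 + n3 * n4) * A1 n1 n2 n3 n4)) by [].
have F_out k : (m * n1 < k)%N -> F k = 0.
  by move=> k_gt; rewrite /F gbinom_small // !(mulr0, mul0r).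
(* The range is completed to full blocks of length m; the added terms are 0. *)
have -> : \sum_(0 <= k < (m * n1).+1) F k = \sum_(0 <= k < m * n1.+1) F k.
  rewrite [RHS](@big_cat_nat _ _ _ (m * n1).+1) ?ltn_pmul2l //=.
  rewrite [X in _ = _ + X]big_nat [X in _ = _ + X]big1 ?addr0 //.
  by move=> k /andP[k_gt _]; apply: F_out.
rewrite sum_blocks -A1_sum -sumrMnr -big_split /=.
apply: eqm_sum => j /andP[_ j_lt] _; rewrite big_ltn // addn0 mulrnDr addrA.
apply: eqmD.
  have w_near : near (w (m * j)%N) (w (m * j)%N) 1 0.
    split; first by rewrite mulr0 addr0; apply: eqmxx.
    by have := w_mod j 0%N m_gt0; rewrite addn0 leq_mul2l -ltnS j_lt orbT; apply.
  have := nearM (nearM (nearM (nearM w_near (near_gb n1 j)) (near_gb n3 j))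
    (near_gb (n1 + n2 - j) n1)) (near_gb (n3 + n4 - j) n3).
  case=> + _; rewrite /F /V -!mulnDr -!mulnBr => /eqm_trans; apply; exists 0.
  rewrite mul0r addr0; congr (_ + _); rewrite -[in RHS]mulr_natr; congr (_ * _).
  rewrite /A1_term /A1_diag !(natrD, natrM); ring.
(* If j >= n1 or j >= n3, both [A1_off] and the rest of the block vanish. *)
have [|j_ge] := boolP ((j < n1) && (j < n3))%N; last first.
  have -> : A1_off n1 n2 n3 n4 j = 0%N.
    move: j_ge; rewrite negb_and -!leqNgt A1_offE /A1_term.
    by case/orP => j_ge; rewrite (@bin_small _ j.+1 j_ge) ?(mul0n, muln0).
  rewrite muln0 mulr0n; apply: eqm_sum0 => r /andP[r_gt0 _] _.
  have out n : (n <= j)%N -> gb (m * n) (m * j + r) = 0.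
    by move=> le_nj; apply: gbinom_small; nia.
  move: j_ge; rewrite negb_and -!leqNgt /F => /orP[] /out ->;
    rewrite ?(mulr0, mul0r); exact: eqmxx.
move=> /andP[j1 j3].
rewrite mulrnA T2 -sumrMnl; apply: eqm_sum => r rm _.
have [r_gt0 r_lt] := andP rm.
have ndvd : ~~ (m %| m * j + r)%N by rewrite dvdn_addr ?dvdn_mulr // gtnNdvd.
(* As r > 0, the upper index is m (a + b - j - 1) + (m - r), whence j + 1. Modulo P suffices, since
   the first two binomials supply P^2. *)
have rest a b : (j < a)%N -> eqm P (gb (m * a + m * b - (m * j + r)) (m * a)) 'C(a + b - j.+1, a)%:R.
  move=> lt_ja; have -> : (m * a + m * b - (m * j + r) = m * (a + b - j.+1) + (m - r))%N by nia.
  by apply: gbinom_Lucas => //; lia.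
have lead n := gbinom_ndvd2 m_gt0 qm1 gbinom_m n ndvd.
pose N n := (n * 'C(n.-1, j))%N.
have {lead} lead n : eqm (P ^+ 2) (gb (m * n) (m * j + r)) (gb m r *+ N n).
  have := lead n.
  by rewrite (mulnC m j) divnMDl // modnMDl modn_small // divn_small // addn0.
have lead1 : eqm P (gb (m * n1) (m * j + r)) 0 by apply: gbinom_ndvd.
(* The two binomials are replaced in turn modulo P^2, the other factor being divisible by P each
   time. *)
have prod : eqm (P ^+ 3) (gb (m * n1) (m * j + r) * gb (m * n3) (m * j + r))
    (gb m r ^+ 2 *+ (N n1 * N n3)).
  apply: eqm_trans (_ : eqm _ (gb (m * n1) (m * j + r) * (gb m r *+ N n3)) _).
    exact: (@eqm_lift _ P 1 2 _ _ _ lead1 (lead n3)).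
  rewrite mulrnAr mulrC (mulrnA _ (N n1)) expr2 -[X in eqm _ _ (X *+ _)]mulrnAr; apply: eqmMn.
  exact: (@eqm_lift _ P 1 2 _ _ _ (gbinom_m rm) (lead n1)).
rewrite /F; apply: eqm_trans (_ : eqm _ (gb (m * n1) (m * j + r) * gb (m * n3) (m * j + r)
  * (w (m * j + r)%N * gb (m * n1 + m * n2 - (m * j + r)) (m * n1)
       * gb (m * n3 + m * n4 - (m * j + r)) (m * n3))) _).
  by exists 0; ring.
apply: eqm_trans (eqmMr _ prod) _.
have -> : q ^+ (r ^ 2) * gb m r ^+ 2 *+ A1_off n1 n2 n3 n4 j
    = gb m r ^+ 2 *+ (N n1 * N n3)
      * (q ^+ (r ^ 2) * 'C(n1 + n2 - j.+1, n1)%:R * 'C(n3 + n4 - j.+1, n3)%:R).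
  rewrite /A1_off -/(N n1) -/(N n3) mulrnAl -[LHS]mulr_natr -[RHS]mulr_natr !natrM.
  ring.
rewrite !mulrnAl; apply: eqmMn; apply: (@eqm_lift _ P 2 1 _ _ _ (gbinom_m2 rm)).
apply: eqmM (rest _ _ j3); apply: eqmM (rest _ _ j1); apply: w_mod; nia.
Qed.

End Supercongruence.

(** * Evaluation at a primitive root of unity *)

(** A closed form cleared of denominators; for n = M = m and x^m = 1 only 2 m x (1 - x) is left. *)
Lemma sum_quadratic_geom (R : comNzRingType) (M x : R) n :
  (1 - x) ^+ 3 * (\sum_(0 <= i < n) i%:R * (M - i%:R) * x ^+ i)
  = x ^+ n * ((1 - x) ^+ 2 * n%:R ^+ 2
              + (2 * x * (1 - x) - M * (1 - x) ^+ 2) * n%:R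
              + x * (1 + x - M * (1 - x)))
    - x * (1 + x - M * (1 - x)).
Proof.
elim: n => [|n IHn]; first by rewrite big_geq // expr0 mulr0n; ring.
rewrite big_nat_recr //= mulrDr IHn (exprS x n) -[n.+1]addn1 natrD; ring.
Qed.

(* x / (1 - x)^2 is thus a polynomial in x on the nontrivial m-th roots of
   unity, so that it can be summed over them. *)
Lemma sum_quadratic_unity (F : fieldType) m (x : F) : x ^+ m = 1 -> x != 1 ->
  (1 - x) ^+ 2 * (\sum_(0 <= i < m) i%:R * (m%:R - i%:R) * x ^+ i) = 2 * m%:R * x.
Proof.
move=> xm x1; have x1' : 1 - x != 0 by rewrite subr_eq0 eq_sym.
apply: (mulfI x1'); rewrite mulrA -exprS sum_quadratic_geom xm; ring.
Qed.

Lemma sum_quadratic (R : comNzRingType) (M : R) n :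
  6 * (\sum_(0 <= i < n) i%:R * (M - i%:R)) = n%:R * (n%:R - 1) * (3 * M - 2 * n%:R + 1).
Proof.
elim: n => [|n IHn]; first by rewrite big_geq // mulr0 !mul0r.
rewrite big_nat_recr //= mulrDr IHn -[n.+1]addn1 natrD; ring.
Qed.

Section RootOfUnity.
Variables (m : nat) (F : numFieldType) (z : F).
Hypothesis z_prim : m.-primitive_root z.

Let m_gt0 : (0 < m)%N. Proof. exact: prim_order_gt0 z_prim. Qed.

Let zm : z ^+ m = 1. Proof. exact: prim_expr_order z_prim. Qed.

Let z_neq1 c : (0 < c < m)%N -> z ^+ c != 1.
Proof.
move=> /andP[c_gt0 c_lt]; rewrite -(prim_order_dvd z_prim).
by rewrite gtnNdvd.
Qed.

Lemma prim_root_sub_neq0 c : (0 < c < m)%N -> 1 - z ^+ c != 0.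
Proof. by move=> cm; rewrite subr_eq0 eq_sym z_neq1. Qed.

Lemma sum_prim_root i : (0 < i < m)%N -> \sum_(1 <= c < m) (z ^+ c) ^+ i = -1.
Proof.
move=> im; apply/eqP; rewrite -addr_eq0 addrC.
have -> : 1 + \sum_(1 <= c < m) (z ^+ c) ^+ i = \sum_(c < m) (z ^+ i) ^+ c.
  rewrite -(big_mkord xpredT (fun c => (z ^+ i) ^+ c)) big_ltn //; congr (_ + _).
  by apply: eq_bigr => c _; rewrite exprAC.
have := subrX1 (z ^+ i) m; rewrite exprAC zm expr1n subrr => /esym/eqP.
by rewrite mulf_eq0 subr_eq0 (negPf (z_neq1 im)).
Qed.

(** By [sum_quadratic_unity] each term is a polynomial in z^c; exchanging the sums leaves power
    sums, equal to -1, and the sum of i (m - i). *)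
Lemma sum_inv_prim_root :
  \sum_(1 <= c < m) z ^+ c / (1 - z ^+ c) ^+ 2 = - ((m%:R ^+ 2 - 1) / 12).
Proof.
have m_neq0 : m%:R != 0 :> F by rewrite pnatr_eq0 -lt0n.
transitivity (\sum_(1 <= c < m) (2 * m%:R)^-1
  * \sum_(0 <= i < m) i%:R * (m%:R - i%:R) * (z ^+ c) ^+ i).
  rewrite big_nat [RHS]big_nat; apply: eq_bigr => c cm.
  have zcm : (z ^+ c) ^+ m = 1 by rewrite exprAC zm expr1n.
  have E := sum_quadratic_unity zcm (z_neq1 cm).
  have zc := prim_root_sub_neq0 cm.
  apply: (mulfI (expf_neq0 2 zc)); rewrite [RHS]mulrCA E; field.
  by rewrite ?zc ?m_neq0.
rewrite -mulr_sumr exchange_big /=.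
under eq_bigr do rewrite -mulr_sumr.
transitivity ((2 * m%:R)^-1 * \sum_(0 <= i < m) - (i%:R * (m%:R - i%:R)) : F).
  (* For i = 0 the power sum is m - 1 instead, but its weight is 0. *)
  congr (_ * _); rewrite big_nat [RHS]big_nat; apply: eq_bigr => -[_|i im].
    by rewrite !mul0r oppr0.
  by rewrite sum_prim_root // mulrN1.
rewrite sumrN mulrN; congr (- _).
have := sum_quadratic (m%:R : F) m => E.
apply: (mulfI (_ : 6 != 0 :> F)); first by rewrite pnatr_eq0.
rewrite mulrCA E; field.
by rewrite m_neq0.
Qed.

Lemma gbinom_prim_root c : (0 < c < m)%N -> gbinom z m c = 0.
Proof.
move=> cm; apply: (mulIf (prim_root_sub_neq0 cm)); case: c cm => // c _.
by rewrite -{1}(prednK m_gt0) gbinom_absorb (prednK m_gt0) zm subrr !mul0r.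
Qed.

(** As [gbinom z m c.+1] is 0, q-Pascal gives [gbinom z m.-1 c] = (-1)^c z^(-c(c+1)/2); squaring
    removes the sign and the halved exponent. *)
Lemma gbinom_pred_prim_root c : (c < m)%N ->
  z ^+ (c.+1 ^ 2) * gbinom z m.-1 c ^+ 2 = z ^+ c.+1.
Proof.
elim: c => [|c IHc] c_lt; first by rewrite gbinom0 expr1n mulr1.
have := gbinom_prim_root (c := c.+1) c_lt.
rewrite -{1}(prednK m_gt0) gbinomS => /eqP; rewrite addr_eq0 => /eqP E.
have Ez : z ^+ (c.+2 ^ 2) = z * (z ^+ (c.+1 ^ 2) * z ^+ (c.+1 * 2)).
  by rewrite -exprD -exprS; congr (_ ^+ _); lia.
rewrite [RHS]exprS -(IHc (ltnW c_lt)) E Ez sqrrN exprMn -exprM.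
by move: (z ^+ _) (z ^+ _) => a b; ring.
Qed.

End RootOfUnity.

Local Notation Phi m := (map_poly (intr : int -> rat) 'Phi_m).

(** Phi_m is the minimal polynomial of z over the rationals, so one evaluation decides
    divisibility. *)
Lemma Phi_dvd m (z : algC) (f : {poly rat}) : m.-primitive_root z ->
  root (map_poly ratr f) z -> exists g, f = g * Phi m.
Proof.
move=> z_prim; have [p [p_min _] p_dvd] := minCpolyP z.
have -> : Phi m = p.
  apply: (map_poly_inj (ratr : {rmorphism rat -> algC})).
  rewrite -p_min (minCpoly_cyclotomic z_prim) -(Cintr_Cyclotomic z_prim) -map_poly_comp.
  by apply: eq_map_poly => i /=; rewrite ratr_int.
by rewrite p_dvd => /dvdpP[g ->]; exists g.
Qed.

(** * The value of S modulo Phi_m^3 *)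

Section Defect.
Variable m : nat.
Hypothesis m_gt0 : (0 < m)%N.
Local Notation P := (Phi m).
Local Notation gb := (gbinom ('X : {poly rat})).

Let Phi_eqm0 (z : algC) (f : {poly rat}) : m.-primitive_root z ->
  (map_poly ratr f).[z] = 0 -> eqm P f 0.
Proof. by move=> z_prim /eqP/(Phi_dvd z_prim)[g ->]; exists g; rewrite add0r. Qed.

Lemma eqm_Xm : eqm P ('X ^+ m) 1.
Proof.
have [z z_prim] := C_prim_root_exists m_gt0.
have [|h] := Phi_eqm0 (f := 'X ^+ m - 1) z_prim.
  by rewrite rmorphB rmorphXn rmorph1 /= map_polyX !hornerE (prim_expr_order z_prim) subrr.
by rewrite add0r => /eqP; rewrite subr_eq addrC => /eqP ->; exists h.
Qed.

Let horner_gb (z : algC) n k : (map_poly ratr (gb n k)).[z] = gbinom z n k.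
Proof.
rewrite (rmorph_gbinom (map_poly ratr : {rmorphism {poly rat} -> {poly algC}})) /= map_polyX.
rewrite -[LHS]/(horner_eval z _) (rmorph_gbinom (horner_eval z : {rmorphism {poly algC} -> algC})) /=.
by rewrite /horner_eval hornerX.
Qed.

Lemma eqm_gbinom_X c : (0 < c < m)%N -> eqm P (gb m c) 0.
Proof.
have [z z_prim] := C_prim_root_exists m_gt0.
by move=> cm; apply: (Phi_eqm0 z_prim); rewrite horner_gb gbinom_prim_root.
Qed.

Lemma eqm_defect : eqm (P ^+ 3) (gbinom_defect ('X : {poly rat}) m)
  (- ((m%:R ^+ 2 - 1) / 12)%:P * ('X ^+ m - 1) ^+ 2).
Proof.
have [z z_prim] := C_prim_root_exists m_gt0.
have [psi psiE] := eqm_Xm.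
have P_neq0 : P != 0.
  exact/monic_neq0/monic_map/Cyclotomic_monic.
pose g c := gb m c %/ P.
have gE c : (0 < c < m)%N -> gb m c = g c * P.
  by move=> /eqm_gbinom_X[h]; rewrite add0r /g => ->; rewrite mulpK.
(* [f] is the difference of the two sides divided by P^2, so it only has to vanish at z. *)
pose f := \sum_(1 <= c < m) 'X ^+ (c ^ 2) * g c ^+ 2 + ((m%:R ^+ 2 - 1) / 12)%:P * psi ^+ 2.
have [|h fE] := Phi_eqm0 (f := f) z_prim.
  pose ev := fun u : {poly rat} => (map_poly ratr u).[z].
  (* The absorption identity is divided by P before evaluation, since both of its sides vanish at
     z. *)
  have gz c : (0 < c < m)%N -> ev (g c) * (1 - z ^+ c) = - ev psi * gbinom z m.-1 c.-1.
    case: c => // c cm.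
    have : g c.+1 * (1 - 'X ^+ c.+1) = - psi * gb m.-1 c.
      apply: (mulIf P_neq0); rewrite mulrAC -gE //.
      rewrite -{1}(prednK m_gt0) gbinom_absorb (prednK m_gt0) psiE; ring.
    move/(congr1 ev); rewrite /ev !rmorphM /= rmorphB rmorphN rmorph1 rmorphXn /= map_polyX.
    by rewrite !hornerE horner_gb.
  rewrite rmorphD rmorph_sum hornerD horner_sum rmorphM rmorphXn /= map_polyC hornerM.
  rewrite hornerC horner_exp -/(ev psi).
  transitivity (ev psi ^+ 2 * (\sum_(1 <= c < m) z ^+ c / (1 - z ^+ c) ^+ 2
      + (m%:R ^+ 2 - 1) / 12)); last first.
    by rewrite (sum_inv_prim_root z_prim) addNr mulr0.
  rewrite mulrDr mulr_sumr; congr (_ + _); last first.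
    rewrite mulrC; congr (_ * _).
    by rewrite /= fmorph_div rmorphB rmorphXn rmorph1 !rmorph_nat.
  rewrite big_nat [RHS]big_nat; apply: eq_bigr => c cm.
  rewrite rmorphM !rmorphXn /= map_polyX !hornerE -/(ev (g c)).
  have -> : ev (g c) = - ev psi * gbinom z m.-1 c.-1 / (1 - z ^+ c).
    by rewrite -gz // mulfK // (prim_root_sub_neq0 z_prim).
  have := gbinom_pred_prim_root z_prim (c := c.-1).
  have zc := prim_root_sub_neq0 z_prim cm.
  case: c cm zc => // c cm zc /=; rewrite ltnW // => /(_ isT) E.
  move: (1 - z ^+ c.+1) zc => d d_neq0; rewrite -E; field.
  by rewrite d_neq0.
exists h; rewrite psiE [1 + _]addrC addrK.
have -> : gbinom_defect ('X : {poly rat}) m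
    = (f - ((m%:R ^+ 2 - 1) / 12)%:P * psi ^+ 2) * P ^+ 2.
  rewrite /f addrK mulr_suml /gbinom_defect big_nat [RHS]big_nat.
  by apply: eq_bigr => c cm; rewrite gE //; ring.
rewrite fE; ring.
Qed.

End Defect.

(** * Laurent polynomials *)

Lemma eqm_meval n (R : comNzRingType) (d : R) (p : {mpoly R[n]}) (u v : 'I_n -> R) :
  (forall i, eqm d (u i) (v i)) -> eqm d p.@[u] p.@[v].
Proof.
move=> uv; rewrite !mevalE; apply: (big_ind2 (eqm d)); first exact: eqmxx.
  by move=> *; apply: eqmD.
move=> e _; apply: eqmMl; apply: (big_ind2 (eqm d)); first exact: eqmxx.
  by move=> *; apply: eqmM.
by move=> i _; apply: eqmX.
Qed.

Section Exponent.
Variable alpha : {mpoly int[5]}.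

Lemma alpha_at_scale (m n1 n2 n3 n4 : nat) (k : int) : quadratic_scaling alpha ->
  alpha_at alpha (m * n1) (m * n2) (m * n3) (m * n4) (m%:Z * k)
  = m%:Z ^+ 2 * alpha_at alpha n1 n2 n3 n4 k.
Proof.
move=> /(_ m%:Z) scale; rewrite /alpha_at -mevalZ -scale comp_mpoly_meval.
apply: meval_eq => i; rewrite tnth_mktuple mevalZ mevalXU.
by case: i => -[|[|[|[|[|i]]]]] //= ?; rewrite !(tnth_nth 0) /= ?PoszM.
Qed.

(** Modulo m the arguments m n_i vanish, which leaves alpha(0, k) = k^2. *)
Lemma alpha_at_mod (m n1 n2 n3 n4 : nat) (k : int) : square_at_zero alpha ->
  eqm m%:Z (alpha_at alpha (m * n1) (m * n2) (m * n3) (m * n4) k) (k ^+ 2).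
Proof.
move=> zero; pose v := tnth [tuple 0; 0; 0; 0; k].
have <- : alpha.@[v] = k ^+ 2.
  have := congr1 (meval (fun=> k)) zero.
  rewrite comp_mpoly_meval rmorphXn /= mevalXU => <-; apply: meval_eq => i.
  case: i => -[|[|[|[|[|i]]]]] //= ?; rewrite !(tnth_nth 0) /= ?meval0 //.
  by rewrite mevalXU.
have m_dvd a : eqm m%:Z (m * a)%N%:Z 0 by exists a%:Z; rewrite add0r PoszM mulrC.
apply: eqm_meval => i; rewrite /v !(tnth_nth 0).
by case: i => -[|[|[|[|[|i]]]]] //= _; apply: eqmxx.
Qed.

End Exponent.

(** For k > n3, where natural subtraction may truncate, both sides are 0. *)
Lemma Aq_term_gbinom (F : fieldType) (q : F) alpha (n1 n2 n3 n4 k : nat) :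
    (forall i, (0 < i)%N -> q ^+ i != 1) -> (k <= n1)%N ->
  Aq_term q alpha n1 n2 n3 n4 k
  = q ^ alpha_at alpha n1 n2 n3 n4 k * (gbinom q n1 k * gbinom q n3 k
      * gbinom q (n1 + n2 - k) n1 * gbinom q (n3 + n4 - k) n3).
Proof.
move=> q_free le_kn1; rewrite /Aq_term !qbinom_nat //.
have [le_kn3|lt_n3k] := leqP k n3; last first.
  by rewrite (gbinom_small _ lt_n3k) !(mulr0, mul0r).
have le1 : (k <= n1 + n2)%N by rewrite (leq_trans le_kn1) ?leq_addr.
have le3 : (k <= n3 + n4)%N by rewrite (leq_trans le_kn3) ?leq_addr.
by rewrite -!PoszD (subzn le1) (subzn le3) !qbinom_nat // !mulrA.
Qed.

Lemma tofrac_eq1 (p : {poly rat}) : (tofrac p == 1 :> Qq) = (p == 1).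
Proof. by rewrite -tofrac1 tofrac_eq. Qed.

Lemma q__free i : (0 < i)%N -> q_ ^+ i != 1.
Proof.
move=> i_gt0; rewrite /q_ -tofracXn tofrac_eq1; apply/eqP => /(congr1 (size \o polyseq)).
by rewrite /= size_polyXn size_poly1 => -[] i0; rewrite i0 in i_gt0.
Qed.

Lemma q__neq0 : q_ != 0.
Proof. by rewrite /q_ tofrac_eq0 polyX_eq0. Qed.

Lemma tofrac_gbinom (p : {poly rat}) n k :
  tofrac (gbinom p n k) = gbinom (tofrac p) n k :> Qq.
Proof. exact: (rmorph_gbinom (@tofrac {poly rat})). Qed.

Theorem theorem10 (alpha : {mpoly int[5]})
    (alpha_scale : quadratic_scaling alpha)
    (alpha_zero : square_at_zero alpha)
    (m : nat) (m_gt0 : (0 < m)%N) (n1 n2 n3 n4 : nat) :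
  laurent_eqmod
    (Aq q_ alpha (m * n1) (m * n2) (m * n3) (m * n4))
    (Aq (q_ ^+ (m ^ 2)) alpha n1 n2 n3 n4
       - cst ((m%:R ^+ 2 - 1) / 12) * (q_ ^+ m - 1) ^+ 2
         * cst (Rn n1 n2 n3 n4))
    (PhiQ m ^+ 3).
Proof.
pose al k := alpha_at alpha (m * n1) (m * n2) (m * n3) (m * n4) k%:Z.
(* The factor q^(m^2 N) clears the negative powers of q and is 1 mod Phi_m. *)
pose N := (\sum_(0 <= k < (m * n1).+1) absz (al k))%N.
pose e k := absz (al k + (m ^ 2 * N)%N%:Z).
have eE k : (k <= m * n1)%N -> (e k)%:Z = al k + (m ^ 2 * N)%N%:Z.
  move=> k_le; rewrite gez0_abs //.
  have : (absz (al k) <= N)%N.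
    by rewrite /N big_mkord (bigD1 (Ordinal (k_le : (k < (m * n1).+1)%N))) //= leq_addr.
  have : (0 < m ^ 2)%N by rewrite expn_gt0 m_gt0.
  nia.
pose w k : {poly rat} := 'X ^+ e k.
have w_mod j r : (r < m)%N -> (m * j + r <= m * n1)%N ->
    eqm (Phi m) (w (m * j + r)%N) ('X ^+ (r ^ 2)).
  move=> r_lt k_le; apply: (eqm_expq (m := m)); first exact: eqm_Xm.
  have [h] := alpha_at_mod m n1 n2 n3 n4 (m * j + r)%N alpha_zero.
  rewrite -/(al _) => alE.
  suff: ((e (m * j + r)%N)%:Z = (r ^ 2)%N%:Z %[mod m])%Z by rewrite !modz_nat => -[].
  apply/eqP; rewrite eqz_mod_dvd (eE _ k_le) alE; apply/dvdzP.
  (* The summands come from (m j + r)^2 - r^2, from the congruence for alpha and from the shift m^2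
     N. *)
  exists (m%:Z * j%:Z ^+ 2 + 2 * j%:Z * r%:Z + h + m%:Z * N%:Z).
  rewrite !(PoszD, PoszM); ring.
have half2 : (2^-1)%:P *+ 2 = 1 :> {poly rat}.
  by rewrite -polyCMn (_ : 2^-1 *+ 2 = 1 :> rat).
have main := gbinom_supercongruence m_gt0 (eqm_Xm m_gt0) (@eqm_gbinom_X m m_gt0)
  half2 n2 n3 n4 w_mod.
set W := \sum_(0 <= k < _) _ in main; set V := \sum_(0 <= j < _) _ in main.
have defect := eqm_defect m_gt0.
(* Phi_m^2 divides (q^m - 1)^2, so the clearing factor is needed only modulo Phi_m. *)
have X_mod : eqm (Phi m ^+ 3) ('X ^+ (m ^ 2 * N) * ('X ^+ m - 1) ^+ 2) (('X ^+ m - 1) ^+ 2).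
  have U0 : eqm (Phi m ^+ 2) (('X ^+ m - 1) ^+ 2) 0.
    have [h ->] := eqm_Xm m_gt0; exists (h ^+ 2); ring.
  rewrite mulrC -[X in eqm _ _ X]mulr1; apply: (@eqm_lift _ _ 2 1 _ _ _ U0).
  by rewrite -[(m ^ 2)%N]/(m * m)%N -mulnA; apply: eqm_expqm; apply: eqm_Xm.
(* The claim multiplied by q^(m^2 N), as a congruence of polynomials. *)
have [H HE] : eqm (Phi m ^+ 3) (W - V + 'X ^+ (m ^ 2 * N)
   * ('X ^+ m - 1) ^+ 2 * (((m%:R ^+ 2 - 1) / 12) * Rn n1 n2 n3 n4)%:P) 0.
  case: main => h1 ->; case: defect => h2 ->; case: X_mod => h3 ->.
  pose r := ((m%:R ^+ 2 - 1) / 12 : rat)%:P : {poly rat}.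
  pose M := ((n1 * n2 + n3 * n4) * A1 n1 n2 n3 n4)%N.
  have -> : (((m%:R ^+ 2 - 1) / 12) * Rn n1 n2 n3 n4)%:P = r * ((2^-1)%:P * M%:R).
    by rewrite /r /M /Rn -polyC_natr -!polyCM; congr (_%:P); rewrite natrM; field.
  rewrite -/r -/M -[_ *+ M]mulr_natr.
  exists (h1 + h2 * ((2^-1)%:P * M%:R) + h3 * (r * ((2^-1)%:P * M%:R))); ring.
exists (tofrac H / q_ ^+ (m ^ 2 * N)); first by exists H, (m ^ 2 * N)%N.
have qK : q_ ^+ (m ^ 2 * N) != 0 by rewrite expf_neq0 ?q__neq0.
have WE : tofrac W = q_ ^+ (m ^ 2 * N) * Aq q_ alpha (m * n1) (m * n2) (m * n3) (m * n4).
  rewrite rmorph_sum mulr_sumr /= big_nat [RHS]big_nat; apply: eq_bigr => k k_le.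
  rewrite (Aq_term_gbinom _ _ _ _ q__free) // mulrA (exprnP q_) -expfzDr ?q__neq0 //.
  rewrite addrC -(eE k) // -exprnP !tofracM !tofrac_gbinom /w tofracXn -!mulrA //.
have Q_free i : (0 < i)%N -> (q_ ^+ (m ^ 2)) ^+ i != 1.
  by move=> i_gt0; rewrite -exprM q__free // muln_gt0 expn_gt0 m_gt0.
have VE : tofrac V = q_ ^+ (m ^ 2 * N) * Aq (q_ ^+ (m ^ 2)) alpha n1 n2 n3 n4.
  rewrite rmorph_sum mulr_sumr /= big_nat [RHS]big_nat; apply: eq_bigr => j /andP[_ j_lt].
  have mj_le : (m * j <= m * n1)%N by rewrite leq_mul2l -ltnS j_lt orbT.
  rewrite (Aq_term_gbinom alpha n2 n3 n4 Q_free (j_lt : (j <= n1)%N)).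
  (* Homogeneity turns q^alpha(m n, m j) into (q^(m^2))^alpha(n, j). *)
  have alE : al (m * j)%N = (m ^ 2)%N%:Z * alpha_at alpha n1 n2 n3 n4 j.
    by rewrite /al PoszM (alpha_at_scale _ _ _ _ _ _ alpha_scale) -mulnn PoszM expr2.
  have powE : q_ ^+ (m ^ 2 * N) * (q_ ^+ (m ^ 2)) ^ alpha_at alpha n1 n2 n3 n4 j
      = q_ ^+ e (m * j)%N.
    rewrite exprnP [q_ ^+ (m ^ 2)]exprnP exprz_exp -expfzDr ?q__neq0 // exprnP.
    by rewrite (eE _ mj_le) alE addrC.
  by rewrite mulrA powE !tofracM !tofrac_gbinom /w !tofracXn -!mulrA.
apply: (mulfI qK).
rewrite mulrBr mulrBr -WE -VE mulrA mulrCA.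
have cancel (a b c : Qq) : c != 0 -> c * (a / c * b) = a * b.
  by move=> c_neq0; rewrite mulrA [c * _]mulrCA divff // mulr1.
have regroup (R : comNzRingType) (a b c x y : R) : a - (b - c * x * y) = a - b + x * (c * y).
  by ring.
rewrite cancel // regroup.
have := congr1 (fun p : {poly rat} => tofrac p : Qq) HE.
rewrite add0r polyCM tofracD tofracB !(tofracXn, tofracM).
by rewrite tofracB tofracXn tofrac1.
Qed.
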